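(* Let $X$ be a $\mathrm{CAT}(0)$ space. The weak topology $\mathcal T_{\Delta}$ on $X$ is finer than the coconvex topology $\mathcal T_{co}$ and coarser than the metric topology $\mathcal T_{metric}$ (in the non-strict sense), that is, $$\mathcal T_{co}\subset \mathcal T_{\Delta}\subset \mathcal T_{metric}.$$ The topology $\mathcal T_{\Delta}$ is sequentially Hausdorff. Any metrically closed, bounded, convex subset $C\subset X$ is $\mathcal T_{\Delta}$-sequentially compact.
   Context: All $\mathrm{CAT}(0)$ spaces are by definition complete and geodesic. A bounded sequence $(x_n)$ in a $\mathrm{CAT}(0)$ space $X$ converges weakly to a point $x\in X$ if for any compact geodesic $c$ in $X$ starting at $x$, the closest-point projections $\mathrm{Proj}_c(x_n)$ of $x_n$ to $c$ converge to $x$. The weak topology $\mathcal T_{\Delta}$ on $X$ is the topology whose closed sets are exactly those subsets $A\subset X$ such that whenever a bounded sequence of points of $A$ converges weakly to a point $x\in X$, one has $x\in A$. (It is the unique sequential topology on $X$ for which a sequence converges to $x$ if and only if it is bounded and converges weakly to $x$.) The coconvex topology $\mathcal T_{co}$ on $X$ is the coarsest topology on $X$ for which all metrically closed, convex subsets of $X$ are closed. A topological space is sequentially Hausdorff if any sequence in it has at most one limit point (i.e. converges to at most one point), and sequentially compact if any sequence in it has a subsequence converging to a point of the space. *)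

(* Defs.v *)
From HB Require Import structures.
From mathcomp Require Import all_boot all_order all_algebra.
From mathcomp Require Import all_classical all_reals all_analysis.

Set Implicit Arguments.
Unset Strict Implicit.
Unset Printing Implicit Defensive.

Import Order.TTheory GRing.Theory Num.Theory.
Import numFieldNormedType.Exports.

Local Open Scope classical_set_scope.
Local Open Scope ring_scope.

Section EuclideanPlane.
Context {R : realType}.

(* The norm that the library puts on 'rV[R]_2 is the sup norm, hence an
   explicit Euclidean distance. *)
Definition edist (a b : 'rV[R]_2) : R :=
  Num.sqrt (\sum_(i < 2) (a ord0 i - b ord0 i) ^+ 2).

Definition esegment (a b : 'rV[R]_2) : set 'rV[R]_2 :=
  [set (1 - t) *: a + t *: b | t in `[0, 1]].

End EuclideanPlane.

Section MetricGeometry.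
Context {R : realType} {X : metricType R}.

Definition geodesic (l : R) (c : R -> X) : Prop :=
  0 <= l /\ {in `[0, l] &, forall s t, mdist (c s) (c t) = `|s - t| }.

Definition geodesic_segment (x y : X) (S : set X) : Prop :=
  exists l c, [/\ geodesic l c, c 0 = x, c l = y & S = c @` `[0, l] ].

Definition geodesic_space : Prop :=
  forall x y : X, exists S, geodesic_segment x y S.

Definition geodesically_convex (C : set X) : Prop :=
  forall x y S, C x -> C y -> geodesic_segment x y S -> S `<=` C.

Definition mbounded (A : set X) : Prop :=
  exists M : R, forall x y, A x -> A y -> mdist x y <= M.

(* The library's complete spaces are pointed; this is the same condition
   without excluding the empty space. *)
Definition complete_space : Prop :=
  forall F : set_system X, ProperFilter F -> cauchy F -> exists x : X, F --> x.

Definition comparison_triangle (p q r : X) (p' q' r' : 'rV[R]_2) : Prop :=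
  [/\ edist p' q' = mdist p q, edist p' r' = mdist p r
    & edist q' r' = mdist q r].

Definition comparison_point (a : X) (a' b' : 'rV[R]_2)
    (x : X) (x' : 'rV[R]_2) : Prop :=
  esegment a' b' x' /\ edist a' x' = mdist a x.

(* Points x, y on two sides issuing from a common vertex p; the other pairs of
   sides are covered by relabelling the vertices, and on a single side the
   inequality is an equality. *)
Definition CAT0_inequality : Prop :=
  forall (p q r : X) (pq pr qr : set X),
    geodesic_segment p q pq -> geodesic_segment p r pr ->
    geodesic_segment q r qr ->
  forall p' q' r', comparison_triangle p q r p' q' r' ->
  forall x y x' y', pq x -> pr y ->
    comparison_point p p' q' x x' -> comparison_point p p' r' y y' ->
    mdist x y <= edist x' y'.

(* Closest-point projection; the default value y is only returned when no
   closest point exists. *)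
Definition mproj (C : set X) (y : X) : X :=
  xget y [set p | C p /\ forall q, C q -> mdist y p <= mdist y q].

Definition weak_cvg (u : nat -> X) (x : X) : Prop :=
  mbounded (range u) /\
  forall l c, geodesic l c -> c 0 = x ->
    mproj (c @` `[0, l]) (u n) @[n --> \oo] --> x.

Definition weak_closed (A : set X) : Prop :=
  forall (u : nat -> X) (x : X), (forall n, A (u n)) -> weak_cvg u x -> A x.

End MetricGeometry.

Arguments geodesic_space {R} X.
Arguments complete_space {R} X.
Arguments CAT0_inequality {R} X.

Definition CAT0 {R : realType} (X : metricType R) : Prop :=
  [/\ complete_space X, geodesic_space X & CAT0_inequality X].

Definition is_topology {T : Type} (O : set_system T) : Prop :=
  [/\ O setT, setI_closed O
    & forall F : set (set T), F `<=` O -> O (\bigcup_(U in F) U)].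

(* [smallest] is the intersection of all such families, that is, the coarsest
   topology in which the given sets are open. *)
Definition coconvex_topology {R : realType} (X : metricType R) : set_system X :=
  smallest is_topology
    [set ~` C | C in [set C : set X | closed C /\ geodesically_convex C]].

(* A copy of X carrying the weak topology instead of the metric one. *)
Definition Delta_space {R : realType} (X : metricType R) : Type := X.

Section DeltaSpace.
Context {R : realType} (X : metricType R).

Lemma mbounded_sub (A B : set X) : A `<=` B -> mbounded B -> mbounded A.
Proof. by move=> AB [M BM]; exists M => x y /AB Bx /AB By; exact: BM. Qed.

Lemma weak_cvg_subseq (u : nat -> X) (x : X) (phi : nat -> nat) :
  (forall n, n <= phi n)%N -> weak_cvg u x -> weak_cvg (u \o phi) x.
Proof.
move=> phi_ge [bu cu]; split.
  by apply: mbounded_sub bu => _ [n _ <-]; exists (phi n).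
move=> l c gc c0; have := cu l c gc c0.
move=> ucv; apply: (cvg_comp phi _ _ ucv).
move=> A [N _ NA]; exists N => // n /= Nn; apply: NA => /=.
exact: leq_trans Nn (phi_ge n).
Qed.

Lemma weak_closedU (A B : set X) :
  weak_closed A -> weak_closed B -> weak_closed (A `|` B).
Proof.
move=> cA cB u x uAB ux.
have [[N uB]|noN] := pselect (exists N, forall n, (N <= n)%N -> B (u n)).
  right; apply: (cB (u \o addn N)) => [n|]; first exact/uB/leq_addr.
  by apply: weak_cvg_subseq => // n; exact: leq_addl.
left; have /choice[phi phiP] : forall N, exists n, (N <= n)%N /\ A (u n).
  move=> N; apply: contrapT => H; apply: noN; exists N => n Nn.
  by have [Aun|//] := uAB n; exfalso; apply: H; exists n.
apply: (cA (u \o phi)) => [n|]; first by case: (phiP n).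
by apply: weak_cvg_subseq => // n; case: (phiP n).
Qed.

Let Delta_open : set_system (Delta_space X) :=
  [set U | weak_closed (~` (U : set X))].

Let Delta_openT : Delta_open setT.
Proof. by rewrite /Delta_open/= setCT => u x /(_ 0%N). Qed.

Let Delta_openI : setI_closed Delta_open.
Proof. by move=> U V oU oV; rewrite /Delta_open/= setCI; exact: weak_closedU. Qed.

Let Delta_open_bigU (I : Type) (f : I -> set (Delta_space X)) :
  (forall i, Delta_open (f i)) -> Delta_open (\bigcup_i f i).
Proof.
move=> of_ u x uf ux [i _ fix_].
by apply: (of_ i u x _ ux fix_) => n fiun; apply: (uf n); exists i.
Qed.

HB.instance Definition _ := Choice.on (Delta_space X).
HB.instance Definition _ := isOpenTopological.Build (Delta_space X)
  Delta_openT Delta_openI Delta_open_bigU.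

(* The topology generated above has exactly the weakly closed sets as its
   closed sets. *)
Lemma Delta_space_closedE :
  closed = [set A : set (Delta_space X) | weak_closed (A : set X)].
Proof.
apply/funext => A; apply/propext; rewrite -openC.
by change (weak_closed (~` ~` (A : set X)) <-> weak_closed (A : set X)); rewrite setCK.
Qed.

End DeltaSpace.

Definition metric_topology {R : realType} (X : metricType R) : set_system X :=
  @open X.

Definition Delta_topology {R : realType} (X : metricType R) : set_system X :=
  @open (Delta_space X).

Arguments coconvex_topology {R} X.
Arguments metric_topology {R} X.
Arguments Delta_topology {R} X.

Definition sequentially_hausdorff (T : topologicalType) : Prop :=
  forall (u : nat -> T) (x y : T),
    u @ \oo --> x -> u @ \oo --> y -> x = y.

Definition sequentially_compact {T : topologicalType} (C : set T) : Prop :=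
  forall u : nat -> T, (forall n, C (u n)) ->
    exists2 phi : nat -> nat, {homo phi : m n / (m < n)%N} &
      exists2 x, C x & (u \o phi) @ \oo --> x.

(* Main.v *)
(* CAT(0) comparison against one side of a triangle gives the uniform convexity
   of the squared distance functions. By completeness it yields closest points
   on closed convex sets, with the Pythagorean inequality, and asymptotic
   centres of bounded sequences. A closed convex C is weakly closed: on the
   geodesic from x to its closest point p in C, every point of C projects to p.
   Every bounded sequence has a weakly convergent subsequence: pass to a
   subsequence whose asymptotic radius cannot be lowered any further, and take
   its asymptotic centre.

   Convergence for the topology Delta is not weak convergence by definition, so
   uniqueness of its sequential limits needs an argument. A sequence leaving
   every bounded set has a weakly closed range, hence a Delta-convergent sequence
   is eventually bounded and has a weakly convergent subsequence v, with limit z;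
   since the range of every tail of v becomes weakly closed after adding z, every
   Delta-limit of v is z. *)
Require Import Defs.
From mathcomp Require Import all_boot all_order all_algebra.
From mathcomp Require Import all_classical all_reals all_analysis.
From mathcomp Require Import ring lra.
Import Order.TTheory GRing.Theory Num.Theory.
Import numFieldNormedType.Exports.

Local Open Scope classical_set_scope.
Local Open Scope ring_scope.

(** * Planar comparison triangles *)

Section comparison.
Context {R : realType}.
Implicit Types a b c d : R.

Definition vec2 a b : 'rV[R]_2 := \row_i (if i == ord0 then a else b).

Lemma edist_vec2 a b c d :
  Defs.edist (vec2 a b) (vec2 c d) = Num.sqrt ((a - c) ^+ 2 + (b - d) ^+ 2).
Proof. by rewrite /Defs.edist !big_ord_recl big_ord0 addr0 !mxE. Qed.

Lemma vec2_comb a b c d s :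
  (1 - s) *: vec2 a b + s *: vec2 c d =
  vec2 ((1 - s) * a + s * c) ((1 - s) * b + s * d).
Proof. by apply/rowP => i; rewrite !mxE; case: ifP. Qed.

(** The law of cosines dictates [x]; Heron's factorisation and the triangle inequalities make
    [b ^+ 2 - x ^+ 2] nonnegative. *)
Lemma triangle_coordinates a b c : 0 < a -> 0 <= b -> 0 <= c ->
    a <= b + c -> b <= a + c -> c <= a + b ->
  exists x y, x ^+ 2 + y ^+ 2 = b ^+ 2 /\ (a - x) ^+ 2 + y ^+ 2 = c ^+ 2.
Proof.
move=> a0 b0 c0 abc bac cab.
pose x := (a ^+ 2 + b ^+ 2 - c ^+ 2) / (2 * a).
have ax : 2 * a * x = a ^+ 2 + b ^+ 2 - c ^+ 2.
  by rewrite /x mulrC divfK// mulf_neq0// gt_eqF.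
have xb : 0 <= b ^+ 2 - x ^+ 2.
  have a2 : 0 < (2 * a) ^+ 2 by rewrite exprn_gt0// mulr_gt0.
  rewrite -(pmulr_rge0 _ a2).
  have -> : (2 * a) ^+ 2 * (b ^+ 2 - x ^+ 2) =
      (2 * a * b) ^+ 2 - (2 * a * x) ^+ 2 by ring.
  rewrite ax.
  have -> : (2 * a * b) ^+ 2 - (a ^+ 2 + b ^+ 2 - c ^+ 2) ^+ 2 =
    ((a + b - c) * (a + b + c)) * ((c - a + b) * (c + a - b)) by ring.
  by rewrite !mulr_ge0//; lra.
exists x, (Num.sqrt (b ^+ 2 - x ^+ 2)); rewrite sqr_sqrtr//; split; first by ring.
have -> : (a - x) ^+ 2 + (b ^+ 2 - x ^+ 2) = a ^+ 2 - 2 * a * x + b ^+ 2 by ring.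
by rewrite ax; ring.
Qed.

End comparison.

(** * Geodesics and comparison along one side of a triangle *)

Section geodesics.
Context {R : realType} {X : metricType R}.
Implicit Types (x y z u p q : X) (c : R -> X) (l t s : R) (C : set X).

Lemma geodesic_dist l c s t : geodesic l c -> 0 <= s <= l -> 0 <= t <= l ->
  mdist (c s) (c t) = `|s - t|.
Proof. by move=> [_ gc] sl tl; apply: gc; rewrite in_itv. Qed.

Lemma geodesic_length l c : geodesic l c -> mdist (c 0) (c l) = l.
Proof.
move=> gc; have l0 : 0 <= l by case: gc.
by rewrite (geodesic_dist _ _ _ _ gc) ?lexx ?l0// sub0r normrN ger0_norm.
Qed.

Lemma geodesic_dist0 l c t : geodesic l c -> 0 <= t <= l ->
  mdist (c 0) (c t) = t.
Proof.
move=> gc /[dup] tl /andP[t0 _]; have l0 : 0 <= l by case: gc.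
by rewrite (geodesic_dist _ _ _ _ gc) ?lexx ?l0// sub0r normrN ger0_norm.
Qed.

Lemma geodesic_distl l c t : geodesic l c -> 0 <= t <= l ->
  mdist (c t) (c l) = l - t.
Proof.
move=> gc /[dup] tl /andP[t0 tl']; have l0 : 0 <= l by case: gc.
by rewrite (geodesic_dist _ _ _ _ gc) ?lexx ?l0// distrC ger0_norm// subr_ge0.
Qed.

Lemma geodesic_sub l c t : geodesic l c -> 0 <= t <= l -> geodesic t c.
Proof.
move=> [l0 gc] /andP[t0 tl]; split=> // r s; rewrite !in_itv/= => /andP[r0 rt] /andP[s0 st].
by apply: gc; rewrite in_itv/= ?r0 ?s0/= (le_trans _ tl).
Qed.

Lemma geodesic_rev l c : geodesic l c -> geodesic l (fun t => c (l - t)).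
Proof.
move=> [l0 gc]; split=> // r s; rewrite !in_itv/= => /andP[r0 rt] /andP[s0 st].
rewrite gc ?in_itv/= ?subr_ge0 ?rt ?st ?lerBlDl ?lerDr//.
have -> : l - r - (l - s) = s - r by ring.
exact: distrC.
Qed.

Lemma image_geodesic_rev l c :
  (fun t => c (l - t)) @` `[0, l] = c @` `[0, l].
Proof.
rewrite eqEsubset; split=> _ [t /= + <-]; rewrite in_itv/= => /andP[t0 tl].
  by exists (l - t) => //=; rewrite in_itv/= subr_ge0 tl lerBlDr lerDl.
exists (l - t); last by rewrite subKr.
by rewrite /= in_itv/= subr_ge0 tl lerBlDr lerDl.
Qed.

(* CAT(0) comparison on one side of the triangle, where Stewart's theorem
   computes the comparison distance; stated without dividing by [l]. *)
Lemma CAT0_stewart u l c t : CAT0 X -> geodesic l c -> 0 <= t <= l ->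
  l * mdist u (c t) ^+ 2 <= (l - t) * mdist u (c 0) ^+ 2
     + t * mdist u (c l) ^+ 2 - t * (l - t) * l.
Proof.
move=> [_ gX cX] gc tl; have l0 : 0 <= l by case: gc.
have [t0 tl'] := andP tl.
move: l0; rewrite le_eqVlt => /predU1P[l0|l0].
  have -> : t = 0 by apply: le_anti; rewrite t0 andbT [leRHS]l0.
  by rewrite -l0 subr0 !mul0r subr0 addr0.
have ll := geodesic_length _ _ gc.
set b := mdist u (c 0); set d := mdist u (c l).
have := metric_triangle (c 0) u (c l); have := metric_triangle u (c 0) (c l).
have := metric_triangle u (c l) (c 0).
rewrite (metric_sym (c l)) (metric_sym (c 0) u) ll => h1 h2 h3.
have [x [y [xy axy]]] : exists x y : R, x ^+ 2 + y ^+ 2 = b ^+ 2 /\ (l - x) ^+ 2 + y ^+ 2 = d ^+ 2.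
  by rewrite /b /d; apply: triangle_coordinates; rewrite ?mdist_ge0//; lra.
have [S1 gS1] := gX (c 0) u; have [S2 gS2] := gX (c l) u.
have gS : geodesic_segment (c 0) (c l) (c @` `[0, l]) by exists l, c.
have tr : comparison_triangle (c 0) (c l) u (vec2 0 0) (vec2 l 0) (vec2 x y).
  split; rewrite edist_vec2 ?sub0r ?subr0 ?sqrrN ?expr0n ?addr0/=.
  - by rewrite sqrtr_sqr ger0_norm ?ltW.
  - by rewrite xy sqrtr_sqr ger0_norm ?mdist_ge0// metric_sym.
  - by rewrite axy sqrtr_sqr ger0_norm ?mdist_ge0// metric_sym.
have := cX _ _ _ _ _ _ gS gS1 gS2 _ _ _ tr (c t) u (vec2 t 0) (vec2 x y).
have -> : mdist (c t) u = mdist u (c t) by rewrite metric_sym.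
rewrite edist_vec2 sub0r sqrrN.
have S1u : S1 u by case: gS1 => k [e [[k0 gk] _ <- ->]]; exists k => //=; rewrite in_itv/= k0 lexx.
have cmp1 : comparison_point (c 0) (vec2 0 0) (vec2 l 0) (c t) (vec2 t 0).
  split.
    exists (t / l).
      by rewrite /= in_itv/= divr_ge0 ?(ltW l0)//= ler_pdivrMr// mul1r.
    by rewrite vec2_comb !mulr0 !add0r divfK// gt_eqF.
  rewrite edist_vec2 !sub0r !sqrrN expr0n addr0 sqrtr_sqr ger0_norm//.
  by rewrite (geodesic_dist0 _ _ _ gc).
have cmp2 : comparison_point (c 0) (vec2 0 0) (vec2 x y) u (vec2 x y).
  split; first by exists 1; rewrite /= ?in_itv/= ?ler01 ?lexx// subrr scale0r scale1r add0r.
  by rewrite edist_vec2 !sub0r !sqrrN xy sqrtr_sqr ger0_norm ?mdist_ge0// metric_sym.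
have cS : (c @` `[0, l]) (c t) by exists t => //=; rewrite in_itv/=.
move=> /(_ cS S1u cmp1 cmp2) le_ut.
have {}le_ut : mdist u (c t) ^+ 2 <= (t - x) ^+ 2 + y ^+ 2.
  by rewrite -[leRHS]sqr_sqrtr ?addr_ge0 ?sqr_ge0// lerXn2r ?nnegrE ?mdist_ge0 ?sqrtr_ge0.
have {}le_ut := ler_wpM2l (ltW l0) le_ut.
apply: le_trans le_ut _.
rewrite -xy -axy.
by rewrite le_eqVlt; apply/orP; left; apply/eqP; ring.
Qed.

(** The Bruhat-Tits inequality, from Stewart's at [t = l / 2]. The geodesic is returned too, so that
    convexity of a set can be applied to it. *)
Lemma CAT0_midpoint x y : CAT0 X -> exists l c,
  [/\ geodesic l c, c 0 = x, c l = y &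
   forall u, mdist u (c (l / 2)) ^+ 2 <=
    mdist u x ^+ 2 / 2 + mdist u y ^+ 2 / 2 - mdist x y ^+ 2 / 4].
Proof.
move=> hX; have [_ gX _] := hX; have [S [l [c [gc c0 cl _]]]] := gX x y.
exists l, c; split=> // u; have [l0 _] := gc.
have ll := geodesic_length _ _ gc.
have hl : 0 <= l / 2 <= l by lra.
have := CAT0_stewart u _ _ _ hX gc hl; rewrite -c0 -cl ll.
move: l0; rewrite le_eqVlt => /predU1P[<-|l0].
  by move=> _; rewrite !mul0r expr0n/= mul0r subr0 -splitr.
by rewrite -(ler_pM2l l0); lra.
Qed.

End geodesics.

(** * Uniform convexity, minimizers and closest points *)

Section projection.
Context {R : realType} {X : metricType R}.
Implicit Types (x y z u p q : X) (c : R -> X) (l t s r e : R) (C A : set X).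

(* [Q y t] reads as "the value at [y] is at most [t]" for some functional that
   is uniformly convex along midpoints. *)
Lemma CAT0_minimizer (Q : X -> R -> Prop) : complete_space X ->
    (exists y t, Q y t) -> (forall y t, Q y t -> 0 <= t) ->
    (forall y s t, s <= t -> Q y s -> Q y t) ->
    (forall x y t, Q x t -> Q y t -> exists m, Q m (t - mdist x y ^+ 2 / 4)) ->
  exists z r, (forall y t, Q y t -> r <= t) /\
    forall e, 0 < e -> exists2 y, Q y (r + e) & mdist z y < e.
Proof.
move=> cX [y0 [t0 Q0]] Qge0 Qle Qmid.
pose S := [set t | exists y, Q y t].
have infS : has_inf S.
  by split; [exists t0, y0 | exists 0 => t [y /Qge0]].
pose r := inf S.
have r_lb y t : Q y t -> r <= t by move=> Qyt; apply: ge_inf; [case: infS | exists y].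
pose A e := [set y | Q y (r + e)].
have A0 e : 0 < e -> A e !=set0.
  move=> e0; have [t [y Qyt] tr] := inf_adherent e0 infS.
  by exists y; apply: Qle Qyt; exact: ltW.
have Asub d e : d <= e -> A d `<=` A e by move=> de y; apply: Qle; rewrite lerD2l.
pose F := filter_from [set e | 0 < e] A.
have PF : ProperFilter F.
  apply: filter_from_proper; last exact: A0.
  apply: filter_from_filter; first by exists 1 => /=.
  move=> d e /= d0 e0; exists (Num.min d e) => /=; first by rewrite lt_min d0.
  by move=> y Ay; split; apply: Asub Ay; rewrite ge_min lexx ?orbT.
have [z Fz] : exists z, F --> z.
  apply: cX; apply: cauchy_exP => e e0.
  (* The value at a midpoint is at least [r], so two points of [A (e ^+ 2 / 8)] satisfy
     [mdist y x ^+ 2 <= e ^+ 2 / 2]; hence [F] is Cauchy. *)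
  have e8 : 0 < e ^+ 2 / 8 by rewrite divr_gt0 ?exprn_gt0.
  have [y Ay] := A0 _ e8; exists y, (e ^+ 2 / 8) => // x Ax.
  rewrite ballEmdist/=; have [m /r_lb] := Qmid _ _ _ Ay Ax.
  rewrite -(@ltr_pXn2r _ 2) ?nnegrE ?mdist_ge0 ?(ltW e0)// => H.
  have : 0 < e ^+ 2 by rewrite exprn_gt0.
  by lra.
exists z, r; split=> // e e0.
have [d /= d0 dz] : F (ball z e) by apply: Fz; exact: nbhsx_ballx.
have [y Ay] : A (Num.min d e) !=set0 by apply: A0; rewrite lt_min d0.
exists y; first by apply: Asub Ay; rewrite ge_min lexx orbT.
suff : ball z e y by rewrite ballEmdist.
by apply: dz; apply: Asub Ay; rewrite ge_min lexx.
Qed.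

(** Transfers a bound on squared distances from [y] to a nearby [z], with an error linear in
    [mdist z y]. *)
Lemma mdist_sqr_le x y z :
  mdist x z ^+ 2 <= mdist x y ^+ 2 + 2 * mdist x z * mdist z y.
Proof.
have := metric_triangle x y z; rewrite (metric_sym y).
have := mdist_ge0 x z; have := mdist_ge0 x y; have := mdist_ge0 z y.
set a := mdist x z; set b := mdist x y; set d := mdist z y => d0 b0 a0 abd.
have [da|ad] := leP d a; last by nra.
have : (a - d) ^+ 2 <= b ^+ 2 by rewrite lerXn2r ?nnegrE//; lra.
by nra.
Qed.

(** First variation at the minimum: minimality inserted in Stewart's inequality at [t], then
    division by [t], leaves an error [t * l], which is made arbitrarily small. *)
Lemma geodesic_minimizer u l c : CAT0 X -> geodesic l c ->
    (forall t, 0 <= t <= l -> mdist u (c 0) <= mdist u (c t)) ->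
  mdist u (c 0) ^+ 2 + l ^+ 2 <= mdist u (c l) ^+ 2.
Proof.
move=> hX gc umin; have [l0 _] := gc.
move: l0; rewrite le_eqVlt => /predU1P[<-|l0]; first by rewrite expr0n addr0.
apply/ler_addgt0Pr => e e0.
pose t := Num.min l (e / l).
have t0 : 0 < t by rewrite lt_min l0 divr_gt0.
have tl : 0 <= t <= l by rewrite ltW//= ge_min lexx.
have tle : t * l <= e by rewrite -ler_pdivlMr// ge_min lexx orbT.
have := CAT0_stewart u _ _ _ hX gc tl.
have /umin : 0 <= t <= l by [].
rewrite -(@ler_pXn2r _ 2) ?nnegrE ?mdist_ge0// -(ler_pM2l l0).
move: (mdist u (c t) ^+ 2) (mdist u (c 0) ^+ 2) (mdist u (c l) ^+ 2) => m a b.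
move=> h1 h2.
have h3 : t * (a + l ^+ 2) <= t * (b + t * l) by nra.
by rewrite ler_pM2l// in h3; lra.
Qed.

Definition closest C x p := C p /\ forall q, C q -> mdist x p <= mdist x q.

(** Convexity keeps midpoints in [C], so [CAT0_minimizer] applies to the squared distance from [x]
    restricted to [C]. *)
Lemma closest_exists C x : CAT0 X -> closed C -> geodesically_convex C ->
  C !=set0 -> exists p, closest C x p.
Proof.
move=> hX cC gC [y0 Cy0].
have cX : complete_space X by case: hX.
have [|y t|y s t st|y z t|p [r [r_lb Hp]]] :=
  CAT0_minimizer (fun y t => C y /\ mdist x y ^+ 2 <= t) cX.
- by exists y0, (mdist x y0 ^+ 2).
- by move=> [_]; apply: le_trans; rewrite sqr_ge0.
- by move=> [Cy ys]; split=> //; exact: le_trans st.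
- move=> [Cy yt] [Cz zt].
  have [l [c [gc c0 cl /(_ x) mid]]] := CAT0_midpoint y z hX.
  exists (c (l / 2)); split; last by lra.
  apply: (gC y z (c @` `[0, l])) => //; first by exists l, c.
  by have [l0 _] := gc; exists (l / 2) => //=; rewrite in_itv/=; lra.
have Cp : C p.
  apply: cC => B /nbhs_ballP[e /= e0 eB].
  have [y [Cy _] pye] := Hp _ e0.
  by exists y; split=> //; apply: eB; rewrite ballEmdist.
exists p; split=> // q Cq.
rewrite -(@ler_pXn2r _ 2) ?nnegrE ?mdist_ge0//.
have rq : r <= mdist x q ^+ 2 by apply: (r_lb q).
apply: le_trans rq; apply/ler_addgt0Pr => e e0.
have xp0 := mdist_ge0 x p.
(* Chosen so that the total error [d + 2 * mdist x p * d] is [e]. *)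
pose d := e / (1 + 2 * mdist x p).
have d0 : 0 < d by rewrite divr_gt0//; lra.
have de : d * (1 + 2 * mdist x p) = e by rewrite divfK// gt_eqF//; lra.
have [y [_ xyr] pyd] := Hp _ d0.
have := mdist_sqr_le x y p; have : mdist x p * mdist p y <= mdist x p * d.
  by rewrite ler_wpM2l// ltW.
by lra.
Qed.

Lemma closest_pythagoras C x p z : CAT0 X -> geodesically_convex C ->
  closest C x p -> C z -> mdist x p ^+ 2 + mdist p z ^+ 2 <= mdist x z ^+ 2.
Proof.
move=> hX gC [Cp minp] Cz; have [_ gX _] := hX.
have [S [l [c [gc c0 cl SE]]]] := gX p z.
rewrite -c0 -cl (geodesic_length _ _ gc); apply: geodesic_minimizer => // t tl.
rewrite c0; apply: minp; apply: (gC p z S) => //; first by exists l, c.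
by rewrite SE; exists t => //=; rewrite in_itv.
Qed.

Lemma mproj_geodesic l c u : geodesic l c -> exists t, [/\ 0 <= t <= l,
   mproj (c @` `[0, l]) u = c t &
   forall s, 0 <= s <= l -> mdist u (c t) <= mdist u (c s)].
Proof.
move=> gc; have [l0 gcE] := gc.
have cf : {within `[0, l], continuous (fun t => mdist u (c t))}.
  apply/subspace_continuousP => t tl; apply/cvgrPdist_le => e e0.
  apply/nbhs_ballP; exists e => //= s tse sl.
  apply: (@le_trans _ _ (mdist (c t) (c s))); last first.
    by rewrite gcE// ltW.
  have := metric_triangle u (c t) (c s); have := metric_triangle u (c s) (c t).
  by rewrite (metric_sym (c s)) ler_norml /from_subspace => ? ?; apply/andP; split; lra.
have [t tl tmin] := EVT_min l0 cf.
(* The minimum just found rules out the default value of [mproj]. *)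
have [[s /= sl <-] smin] : closest (c @` `[0, l]) u (mproj (c @` `[0, l]) u).
  apply: xgetPex; exists (c t); split; first by exists t.
  by move=> _ [s sl <-]; exact: tmin.
exists s; rewrite in_itv/= in sl; split=> // r rl; apply: smin.
by exists r => //=; rewrite in_itv.
Qed.

End projection.

(** * Weak limits, metric limits and closed convex sets *)

Section weak_convergence.
Context {R : realType} {X : metricType R}.
Implicit Types (x y z : X) (u : nat -> X) (c : R -> X) (l t s r e : R) (A C : set X).

Lemma mbounded_range u x (M : R) :
  (forall n, mdist x (u n) <= M) -> mbounded (range u).
Proof.
move=> uM; exists (M + M) => _ _ [m _ <-] [n _ <-].
have := metric_triangle (u m) x (u n); rewrite (metric_sym (u m) x) => h.
by apply: le_trans h _; exact: lerD.
Qed.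

(** A geodesic from [x] to [y] and its reverse have the same image, so the projections to it tend to
    both ends. *)
Lemma weak_cvg_unique u x y : geodesic_space X ->
  weak_cvg u x -> weak_cvg u y -> x = y.
Proof.
move=> gX [_ ux] [_ uy]; have [S [l [c [gc c0 cl _]]]] := gX x y.
have := ux _ _ gc c0.
have := uy _ _ (geodesic_rev _ _ gc); rewrite subr0 image_geodesic_rev => /(_ cl).
by move=> uy' ux'; apply: (cvg_unique (@metric_hausdorff _ X) ux' uy').
Qed.

(** As [x] lies on the geodesic, the projection of [u n] is within [2 * mdist x (u n)] of [x]. *)
Lemma weak_cvg_metric u x : mbounded (range u) -> u @ \oo --> x -> weak_cvg u x.
Proof.
move=> bu ux; split=> // l c gc c0; apply/metricType_numDomainType.cvgrPdist_lt => e e0.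
have e2 : 0 < e / 2 by rewrite divr_gt0.
have [N _ uN] := metricType_numDomainType.cvgr_dist_lt ux e2.
exists N => // n /= /uN /= une.
have [t [tl -> tmin]] := mproj_geodesic l c (u n) gc.
have l0 : 0 <= l by case: gc.
have /tmin : 0 <= (0 : R) <= l by rewrite lexx l0.
rewrite c0 (metric_sym _ x).
have := metric_triangle x (u n) (c t).
by lra.
Qed.

Lemma closed_convex_weak_closed C : CAT0 X -> closed C ->
  geodesically_convex C -> weak_closed C.
Proof.
move=> hX cC gC u x uC [_ ux]; have [_ gX _] := hX.
have [p [Cp minp]] := closest_exists C x hX cC gC (ex_intro _ _ (uC 0)).
have [S [l [c [gc c0 cl _]]]] := gX x p.
suff pE n : mproj (c @` `[0, l]) (u n) = p.
  have := ux _ _ gc c0; rewrite (eq_cvg _ _ pE) => px.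
  suff <- : p = x by [].
  exact: (cvg_unique (@metric_hausdorff _ X) (cvg_cst p) px).
have [t [tl -> tmin]] := mproj_geodesic l c (u n) gc.
have tlE : mdist (c t) p = l - t by rewrite -cl (geodesic_distl _ _ _ gc).
(* By the triangle inequality through [c t], [p] is also closest to [c t]. As [c t] is no farther
   from [u n] than [p], the Pythagorean inequality forces [c t = p]. *)
have cp : closest C (c t) p.
  split=> // q Cq; rewrite tlE.
  have := minp _ Cq; have := metric_triangle x (c t) q.
  have -> : mdist x p = l by rewrite -c0 -cl (geodesic_length _ _ gc).
  have -> : mdist x (c t) = t by rewrite -c0 (geodesic_dist0 _ _ _ gc).
  by lra.
have := closest_pythagoras C (c t) p (u n) hX gC cp (uC n).
have /andP[t0 tl'] := tl; have l0 := le_trans t0 tl'.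
have /tmin : 0 <= l <= l by rewrite lexx l0.
rewrite cl -(@ler_pXn2r _ 2) ?nnegrE ?mdist_ge0// (metric_sym p) (metric_sym (c t) (u n)).
move=> h1 h2; apply: mdist_positivity.
have h3 : mdist (c t) p ^+ 2 <= 0 by lra.
by apply/eqP; rewrite -(@sqrf_eq0 _ (mdist (c t) p)) eq_le h3 sqr_ge0.
Qed.

Lemma weak_closed_closed A : weak_closed A -> closed A.
Proof.
move=> wA x Ax.
have /choice[u uP] : forall n, exists y, A y /\ mdist x y < n.+1%:R^-1.
  move=> n; have n0 : (0 : R) < n.+1%:R^-1 by rewrite invr_gt0.
  have [y [Ay]] := Ax _ (nbhsx_ballx x _ n0).
  by rewrite ballEmdist => xy; exists y.
apply: (wA u) => [n|]; first by case: (uP n).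
apply: weak_cvg_metric.
  apply: (mbounded_range u x 1) => n; have [_ /ltW/le_trans] := uP n; apply.
  by rewrite invf_le1// ler1n.
apply/metricType_numDomainType.cvgrPdist_lt => e e0.
have [N _ ltN] := @near_infty_natSinv_lt R (PosNum e0).
exists N => // n /= /ltN /= ne.
by apply: lt_trans ne; case: (uP n).
Qed.

End weak_convergence.

(** * Diagonal extraction of subsequences *)

Section stable_subset.

Lemma homo_ltn_ge (phi : nat -> nat) :
  {homo phi : m n / (m < n)%N} -> forall n, (n <= phi n)%N.
Proof.
by move=> phi_incr; elim=> // n IH; apply: leq_ltn_trans IH _; exact: phi_incr.
Qed.

(** Infinite index sets encode subsequences, so that refining a subsequence is inclusion. *)
Definition cofinal (S : set nat) := forall N, exists2 n, (N <= n)%N & S n.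

Definition almost_sub (S T : set nat) :=
  exists N, forall n, (N <= n)%N -> S n -> T n.

Lemma cofinal_tail (S : set nat) N : cofinal S -> cofinal (S `&` [set n | (N <= n)%N]).
Proof.
move=> cS K; have [n] := cS (maxn N K); rewrite geq_max => /andP[Nn Kn] Sn.
by exists n.
Qed.

Lemma cofinal_enum (S : set nat) : cofinal S ->
  exists2 phi : nat -> nat, {homo phi : m n / (m < n)%N} & forall n, S (phi n).
Proof.
move=> cS; have /choice[f fP] : forall N, exists n, (N <= n)%N /\ S n.
  by move=> N; have [n] := cS N; exists n.
pose phi := fix F n := if n is m.+1 then f (F m).+1 else f 0%N.
exists phi; last by case=> [|n]; [have [] := fP 0%N | have [] := fP (phi n).+1].
by apply: homo_ltn => [|n]; [exact: ltn_trans | by have [] := fP (phi n).+1].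
Qed.

(* A diagonal argument: [S] is almost contained in each set of a decreasing
   sequence along which [rho] nearly attains its infimum. *)
Lemma stable_cofinal_subset {R : realType} (rho : set nat -> R) :
    (forall S, cofinal S -> 0 <= rho S) ->
    (forall S T, cofinal S -> almost_sub S T -> rho S <= rho T) ->
  exists2 S, cofinal S & forall T, cofinal T -> T `<=` S -> rho S <= rho T.
Proof.
move=> rho0 rho_le.
have step (kS : nat * set nat) : exists T : set nat, cofinal kS.2 ->
    [/\ cofinal T, T `<=` kS.2 & forall T', cofinal T' -> T' `<=` kS.2 ->
      rho T <= rho T' + kS.1.+1%:R^-1].
  case: kS => k S /=; have [cS|ncS] := pselect (cofinal S); last by exists S.
  pose E := [set rho T | T in [set T | cofinal T /\ T `<=` S]].
  have infE : has_inf E.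
    by split; [exists (rho S), S; [split|] | exists 0 => _ [T [/rho0 + _] <-]].
  have k0 : (0 : R) < k.+1%:R^-1 by rewrite invr_gt0.
  have [_ [T [cT TS] <-] Tinf] := inf_adherent k0 infE.
  exists T => _; split=> // T' cT' T'S; apply: (le_trans (ltW Tinf)).
  by rewrite lerD2r; apply: ge_inf; [by case: infE | by exists T'].
have {step}[step stepP] := choice step.
pose Ss := fix F n := if n is m.+1 then step (m, F m) else setT.
have cSs n : cofinal (Ss n).
  elim: n => [N|n IH]; first by exists N.
  by have [] := stepP (n, Ss n) IH.
have SsS n : Ss n.+1 `<=` Ss n by have [] := stepP (n, Ss n) (cSs n).
have Ssub m n : (m <= n)%N -> Ss n `<=` Ss m.
  move=> /subnK <-; elim: (n - m)%N => [//|k IH].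
  by rewrite addSn; apply: subset_trans (SsS _) IH.
have /choice[f fP] : forall N, exists n, (N <= n)%N /\ Ss N n.
  by move=> N; have [n Nn Sn] := cSs N N; exists n.
have Dsub k : almost_sub (range f) (Ss k).
  (* Only the values [f i] with [i < k] may lie outside [Ss k]; the threshold exceeds them all. *)
  exists (\max_(i < k) f i).+1 => n + [j _ fj]; rewrite -{n}fj; have [kj|jk] := leqP k j.
    by move=> _; apply: (Ssub _ _ kj); case: (fP j).
  by rewrite ltnNge (leq_bigmax (Ordinal jk)).
exists (range f).
  by move=> N; exists (f N); [case: (fP N) | exists N].
move=> T cT TD; apply/ler_addgt0Pr => e e0.
have [k _ /(_ k (leqnn k))/= ke] := @near_infty_natSinv_lt R (PosNum e0).
have [_ _ SP] := stepP (k, Ss k) (cSs k).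
have [N DN] := Dsub k.
have := rho_le _ _ _ (Dsub k.+1).
(* A tail of [T] lies in [Ss k], so it competes in the infimum that [Ss k.+1] nearly attains. *)
have T'T : rho (T `&` [set n | (N <= n)%N]) <= rho T.
  by apply: rho_le; [exact: cofinal_tail | exists 0%N => n _ []].
have /SP/= : cofinal (T `&` [set n | (N <= n)%N]) by exact: cofinal_tail.
have T'S : T `&` [set n | (N <= n)%N] `<=` Ss k by move=> n [/TD Dn Nn]; exact: DN.
move=> /(_ T'S) h1 h2.
have {}h2 : rho (range f) <= rho (step (k, Ss k)).
  by apply: h2 => N'; exists (f N'); [case: (fP N') | exists N'].
exact: le_trans h2 (le_trans h1 (lerD T'T (ltW ke))).
Qed.

End stable_subset.

(** * Weak sequential compactness of bounded sequences *)

Section weak_compactness.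
Context {R : realType} {X : metricType R}.
Implicit Types (x y z : X) (c : R -> X) (l t s r e : R) (S T : set nat).

(* [t] bounds the squared limsup distance from [y] to [u] along [S]. *)
Definition asymptotic_bound (u : nat -> X) S y t :=
  exists N, forall n, (N <= n)%N -> S n -> mdist y (u n) ^+ 2 <= t.

(* Following a subsequence none of whose subsequences has a smaller asymptotic
   radius, the asymptotic centre is the weak limit: if the projections to a
   geodesic issuing from the centre stayed at distance [e] from it, the point at
   distance [e] on the geodesic would be a better centre. *)
Lemma bounded_weak_subseq (u : nat -> X) x0 (M : R) : CAT0 X ->
    (forall n, mdist x0 (u n) <= M) ->
  exists2 phi : nat -> nat, {homo phi : m n / (m < n)%N} &
    exists z, weak_cvg (u \o phi) z.
Proof.
move=> hX uM; have [cX _ _] := hX.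
have Q0 S y t : cofinal S -> asymptotic_bound u S y t -> 0 <= t.
  move=> cS [N Nt]; have [n Nn Sn] := cS N.
  by apply: le_trans (Nt n Nn Sn); exact: sqr_ge0.
have QM S : asymptotic_bound u S x0 (M ^+ 2).
  exists 0%N => n _ _; have := uM n; have := mdist_ge0 x0 (u n).
  by nra.
pose rho S := inf [set t | exists y, asymptotic_bound u S y t].
have rho_lb S y t : cofinal S -> asymptotic_bound u S y t -> rho S <= t.
  move=> cS Syt; apply: ge_inf; last by exists y.
  by exists 0 => s [x /Q0]; exact.
have [||D cD Dmin] := stable_cofinal_subset rho.
- move=> S cS; apply: lb_le_inf; first by exists (M ^+ 2), x0.
  by move=> t [y /Q0]; exact.
- move=> S T cS [N ST]; apply: lb_le_inf; first by exists (M ^+ 2), x0.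
  move=> t [y [K Kt]]; apply: (rho_lb S y) => //.
  exists (maxn N K) => n; rewrite geq_max => /andP[Nn Kn] Sn.
  by apply: Kt => //; exact: ST.
have [||y s t st|y z t|z [r [r_lb rz]]] :=
  CAT0_minimizer (asymptotic_bound u D) cX.
- by exists x0, (M ^+ 2).
- by move=> y t; exact: Q0.
- by move=> [N Nt]; exists N => n Nn Dn; exact: le_trans (Nt n Nn Dn) st.
- move=> [N Nt] [K Kt].
  have [l [c [_ _ _ mid]]] := CAT0_midpoint y z hX.
  exists (c (l / 2)), (maxn N K) => n; rewrite geq_max => /andP[Nn Kn] Dn.
  have := mid (u n); rewrite (metric_sym (u n) y) (metric_sym (u n) z).
  rewrite (metric_sym (u n) (c _)).
  have := Nt n Nn Dn; have := Kt n Kn Dn.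
  by lra.
(* A near-minimizer [y] close to [z] passes its bound on to [z]; [K] bounds the distances from [z]
   to the sequence. *)
have zD e : 0 < e -> asymptotic_bound u D z (r + e).
  move=> e0; pose K := mdist z x0 + M.
  have K0 : 0 <= K.
    by rewrite addr_ge0 ?mdist_ge0//; apply: le_trans (uM 0%N); exact: mdist_ge0.
  pose d := e / (1 + 2 * K).
  have d0 : 0 < d by rewrite divr_gt0//; lra.
  have de : d * (1 + 2 * K) = e by rewrite divfK// gt_eqF//; lra.
  have [y [N Nt] zyd] := rz _ d0.
  exists N => n Nn Dn; have yn := Nt n Nn Dn.
  have := mdist_sqr_le (u n) y z; rewrite (metric_sym (u n) y) (metric_sym (u n) z).
  have znK : mdist z (u n) <= K.
    by have := metric_triangle z x0 (u n); have := uM n; rewrite /K; lra.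
  have : mdist z (u n) * mdist z y <= K * d.
    by apply: ler_pM; rewrite ?mdist_ge0// ltW.
  by lra.
have r_cofinal T y t : cofinal T -> T `<=` D -> asymptotic_bound u T y t -> r <= t.
  move=> cT TD Tyt; apply: le_trans (rho_lb _ _ _ cT Tyt).
  apply: le_trans (Dmin _ cT TD).
  apply: lb_le_inf; first by exists (M ^+ 2), x0.
  by move=> s [x]; exact: r_lb.
have [phi phi_incr phiD] := cofinal_enum _ cD.
exists phi => //; exists z; split.
  by apply: (mbounded_range _ x0 M) => n; exact: uM.
move=> l c gc c0; apply/metricType_numDomainType.cvgrPdist_lt => e e0.
pose T := D `&` [set n | e <= mdist z (mproj (c @` `[0, l]) (u n))].
suff /existsNP[N TN] : ~ cofinal T.
  exists N => // n /= Nn; rewrite ltNge; apply/negP => en.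
  apply: TN; exists (phi n); last by split.
  by apply: leq_trans Nn _; exact: homo_ltn_ge.
(* Moving from [z] to [c e] gains at least [e ^+ 2]; half of it pays for the excess of the bound at
   [z] over [r]. *)
move=> cT; have e20 : 0 < e ^+ 2 / 2 by rewrite divr_gt0// exprn_gt0.
have [N zN] := zD _ e20.
suff /r_cofinal : asymptotic_bound u T (c e) (r - e ^+ 2 / 2).
  have TD : T `<=` D by move=> n [].
  by move=> /(_ cT TD); lra.
exists N => n Nn [Dn /=].
have [t [tl -> tmin]] := mproj_geodesic l c (u n) gc.
have [t0 tl'] := andP tl.
rewrite -c0 (geodesic_dist0 _ _ _ gc)// => et.
have gct := geodesic_sub _ _ _ gc tl.
have e_t : 0 <= e <= t by rewrite ltW.
have := CAT0_stewart (u n) _ _ _ hX gct e_t.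
(* The geodesic is reversed so that the closest point [c t] becomes its origin. *)
have gmin s : 0 <= s <= t -> mdist (u n) (c (t - 0)) <= mdist (u n) (c (t - s)).
  move=> /andP[s0 st]; rewrite subr0; apply: tmin.
  by rewrite subr_ge0 st/= (le_trans _ tl')// lerBlDr lerDl.
have := geodesic_minimizer _ _ _ hX (geodesic_rev _ _ gct) gmin.
rewrite subr0 subrr.
have := zN n Nn Dn; rewrite -c0 (metric_sym (c 0)) (metric_sym (c e)).
move: (mdist (u n) (c t) ^+ 2) (mdist (u n) (c 0) ^+ 2) (mdist (u n) (c e) ^+ 2) => P Z W.
move=> h1 h2 h3; have tt0 : 0 < t := lt_le_trans e0 et.
rewrite -(ler_pM2l tt0).
have := ler_wpM2l t0 h1; have := ler_wpM2l (ltW e0) h2.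
have : 0 <= e * t * (t - e) by rewrite !mulr_ge0 ?subr_ge0// ltW.
by lra.
Qed.

End weak_compactness.

(** * Sequential limits in the weak topology *)

Section Delta_convergence.
Context {R : realType} {X : metricType R}.
Implicit Types (x y z : X) (u v w : nat -> X) (A B : set X).

Local Notation "u ~> x" :=
  ((u : nat -> Delta_space X) @ \oo --> (x : Delta_space X)) (at level 70).

Lemma Delta_openE (U : set (Delta_space X)) : open U = weak_closed (~` U : set X).
Proof. by rewrite -[U in open U]setCK openC Delta_space_closedE. Qed.

Lemma cvg_comp_ge (T : topologicalType) (u : nat -> T) (x : T) (phi : nat -> nat) :
  (forall n, n <= phi n)%N -> u @ \oo --> x -> (u \o phi) @ \oo --> x.
Proof.
move=> phi_ge; apply: cvg_comp => A [N _ NA].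
by exists N => // n /= Nn; apply: NA; exact: leq_trans Nn (phi_ge n).
Qed.

Lemma Delta_closed_cvg A u x : weak_closed A -> (forall n, A (u n)) -> u ~> x -> A x.
Proof.
move=> wA uA ux; apply: contrapT => nAx.
have oA : open (~` A : set (Delta_space X)) by rewrite Delta_openE setCK.
have /ux[N _ /(_ N (leqnn N))/=] : nbhs (x : Delta_space X) (~` A).
  exact: open_nbhs_nbhs.
exact.
Qed.

(** Otherwise some reindexing of [u] stays in the weakly closed complement of an open neighbourhood
    of [x], which would then contain [x]. *)
Lemma weak_cvg_Delta u x : weak_cvg u x -> u ~> x.
Proof.
move=> ux A; rewrite nbhsE => -[U [oU Ux] UA].
apply: contrapT => nA; move: oU; rewrite Delta_openE => oU.
have /choice[phi phiP] : forall N, exists n, (N <= n)%N /\ ~ U (u n).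
  move=> N; apply: contrapT => H; apply: nA; exists N => // n /= Nn.
  by apply: UA; apply: contrapT => nU; apply: H; exists n.
apply: (oU (u \o phi) x _ _ Ux) => [n|]; first by case: (phiP n).
by apply: weak_cvg_subseq => // n; case: (phiP n).
Qed.

Lemma weak_cvg_cst x : weak_cvg (fun=> x) x.
Proof.
apply: weak_cvg_metric; last exact: cvg_cst.
by apply: (mbounded_range _ x 0) => n; rewrite mdistxx.
Qed.

Lemma weak_closed1 x : geodesic_space X -> weak_closed [set x].
Proof.
move=> gX u y ux uy; apply: (weak_cvg_unique _ _ _ gX uy).
have -> : u = fun=> x by apply/funext.
exact: weak_cvg_cst.
Qed.

Lemma weak_closed_image_II v N : geodesic_space X -> weak_closed (v @` `I_N).
Proof.
move=> gX; elim: N => [|N IH]; first by rewrite II0 image_set0 => u x /(_ 0%N).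
by rewrite IIS image_setU image_set1; apply: weak_closedU => //; exact: weak_closed1.
Qed.

(** Either [w] and [v] share values arbitrarily far out, or a tail of [w] lies in the union of [B]
    and finitely many values of [v], a weakly closed set. A reindexing with [n <= phi n] preserves
    weak limits. *)
Lemma weak_limit_in_range B v w y : geodesic_space X -> weak_closed B ->
    (forall n, (B `|` range v) (w n)) -> weak_cvg w y ->
  (B `|` range v) y \/
  exists phi psi : nat -> nat,
    [/\ forall n, (n <= phi n)%N, forall n, (n <= psi n)%N
      & w \o phi = v \o psi].
Proof.
move=> gX wB wv wy.
have [often|] := pselect (forall N, exists k m,
    [/\ (N <= k)%N, (N <= m)%N & w k = v m]).
  right; have /choice[phi] := often; move=> /choice[psi phi_psi].
  by exists phi, psi; split=> [n|n|]; [| |apply/funext => n];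
    case: (phi_psi n).
move=> /existsNP[N rarely]; left.
have : (B `|` v @` `I_N) y.
  apply: (weak_closedU wB (weak_closed_image_II v N gX) (u := w \o addn N)).
    move=> k /=; have [|[m _ vm]] := wv (N + k)%N; [by left|right].
    exists m => //=; rewrite ltnNge; apply/negP => Nm; apply: rarely.
    by exists (N + k)%N, m; split=> //; exact: leq_addr.
  by apply: weak_cvg_subseq => // n; exact: leq_addl.
by case=> [|[m _ <-]]; [left | right; exists m].
Qed.

Lemma weak_closed_cvg_range v z : geodesic_space X -> weak_cvg v z ->
  weak_closed ([set z] `|` range v).
Proof.
move=> gX vz w y wv wy.
have [//|[phi [psi [phi_ge psi_ge E]]]] :=
  weak_limit_in_range _ _ _ _ gX (weak_closed1 z gX) wv wy.
left; apply: (weak_cvg_unique (w \o phi) _ _ gX).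
  exact: weak_cvg_subseq.
by rewrite E; exact: weak_cvg_subseq.
Qed.

(** Values shared with the bounded sequence [w] would bound [v] along [psi], although
    [n <= psi n]. *)
Lemma weak_closed_diverging_range v x : geodesic_space X ->
  (forall n, n%:R < mdist x (v n)) -> weak_closed (range v).
Proof.
move=> gX v_inf w y wv wy; have [bw _] := wy.
have [||[]//|[phi [psi [_ psi_ge E]]]] := weak_limit_in_range set0 v w y gX _ _ wy.
- by move=> u ? /(_ 0%N).
- by move=> n; right.
have [K wK] := bw.
pose M := mdist x (w (phi 0%N)) + K.
have MK n : mdist x (v (psi n)) <= M.
  have -> : v (psi n) = w (phi n) by have := congr1 (@^~ n) E.
  by apply: le_trans (metric_triangle x (w (phi 0%N)) _) _; rewrite lerD2l; exact: wK.
have [n Mn] : exists n, M < n%:R.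
  by exists (Num.bound `|M|); apply: le_lt_trans (ler_norm _) _; exact: archi_boundP.
have := lt_trans (v_inf (psi n)) (le_lt_trans (MK n) Mn).
by rewrite ltr_nat ltnNge psi_ge.
Qed.

(** Otherwise some reindexing has a weakly closed range, which contains the limit [x]; yet all its
    terms are at positive distance from [x]. *)
Lemma Delta_cvg_bounded u x : geodesic_space X -> u ~> x ->
  exists N, forall n, (N <= n)%N -> mdist x (u n) <= N%:R.
Proof.
move=> gX ux; apply: contrapT => unb.
have /choice[phi phiP] : forall N, exists n, (N <= n)%N /\ N%:R < mdist x (u n).
  move=> N; apply: contrapT => H; apply: unb; exists N => n Nn.
  by rewrite leNgt; apply/negP => un; apply: H; exists n.
have phi_ge n : (n <= phi n)%N by case: (phiP n).
have [] : range (u \o phi) x.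
  apply: (Delta_closed_cvg _ (u \o phi)) => [|n|]; last exact: cvg_comp_ge.
    by apply: (weak_closed_diverging_range _ x) => // n; case: (phiP n).
  by exists n.
move=> n _ /= unx; have [_] := phiP n.
by rewrite unx mdistxx ltNge ler0n.
Qed.

(** If [x] differs from [z], it is a value of every tail of [v], so a constant reindexing has both
    [x] and [z] as weak limits. *)
Lemma Delta_weak_cvg_unique v x z : geodesic_space X ->
  v ~> x -> weak_cvg v z -> x = z.
Proof.
move=> gX vx vz; apply: contrapT => xz.
have /choice[phi phiP] : forall N, exists n, (N <= n)%N /\ v n = x.
  move=> N; have Nge n : (n <= N + n)%N by exact: leq_addl.
  have [//|[n _ <-]] : ([set z] `|` range (v \o addn N)) x.
    apply: (Delta_closed_cvg _ (v \o addn N)) => [|n|]; last exact: cvg_comp_ge.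
      by apply: weak_closed_cvg_range => //; exact: weak_cvg_subseq.
    by right; exists n.
  by exists (N + n)%N; rewrite leq_addr.
apply/xz/(weak_cvg_unique (v \o phi) _ _ gX).
  have -> : v \o phi = fun=> x by apply/funext => n; case: (phiP n).
  exact: weak_cvg_cst.
by apply: weak_cvg_subseq => // n; case: (phiP n).
Qed.

Lemma Delta_is_topology : is_topology (Delta_topology X).
Proof.
split; [exact: openT | by move=> U V; exact: openI |].
by move=> F FO; apply: bigcup_open.
Qed.

End Delta_convergence.

Theorem proposition3p1 (R : realType) (X : metricType R) (hX : CAT0 X) :
  [/\ coconvex_topology X `<=` Delta_topology X,
      Delta_topology X `<=` metric_topology X,
      sequentially_hausdorff (Delta_space X)
    & forall C : set X, closed C -> mbounded C -> geodesically_convex C ->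
        sequentially_compact (C : set (Delta_space X))].
Proof.
have [_ gX _] := hX; split.
- apply: smallest_sub; first exact: Delta_is_topology.
  move=> _ [C [cC gC] <-]; rewrite /Delta_topology/= Delta_openE setCK.
  exact: closed_convex_weak_closed.
- move=> U; rewrite /Delta_topology /metric_topology/= Delta_openE.
  by move=> /weak_closed_closed; rewrite closedC.
- move=> u x y ux uy.
  have [N uN] := Delta_cvg_bounded u x gX ux.
  (* From index [N] on the sequence is bounded; both limits equal the weak limit of a subsequence of
     this tail. *)
  have [n|phi phi_incr [z uz]] := bounded_weak_subseq (u \o addn N) x N%:R hX.
    by apply: uN; exact: leq_addr.
  have phi_ge n : (n <= N + phi n)%N.
    by apply: leq_trans (homo_ltn_ge _ phi_incr n) _; exact: leq_addl.
  have xz := Delta_weak_cvg_unique _ x z gX (cvg_comp_ge _ _ _ _ phi_ge ux) uz.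
  have yz := Delta_weak_cvg_unique _ y z gX (cvg_comp_ge _ _ _ _ phi_ge uy) uz.
  by rewrite xz yz.
move=> C cC [M CM] gC u uC.
have [n|phi phi_incr [z uz]] := bounded_weak_subseq u (u 0%N) M hX.
  exact: CM.
exists phi => //; exists z; last exact: weak_cvg_Delta.
apply: (closed_convex_weak_closed C hX cC gC _ _ _ uz) => n; exact: uC.
Qed.
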